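(* Let $k$ be a fixed integer with $k\neq 0,\pm 1$, and let $X$ and $Y$ be real vector spaces. A function $f:X\to Y$ with $f(0)=0$ satisfies $$f(x+ky)+f(x-ky)=k^2f(x+y)+k^2f(x-y)+2(1-k^2)f(x)$$ for all $x,y\in X$ if and only if there exist functions $C:X\times X\times X\to Y$, $B:X\times X\to Y$ and $A:X\to Y$ such that $$f(x)=C(x,x,x)+B(x,x)+A(x)\quad\text{for all }x\in X,$$ where $C$ is symmetric for each fixed one variable and additive for fixed two variables, $B$ is symmetric bi-additive, and $A$ is additive.
   Context: A function $A:X\to Y$ is additive if $A(x+y)=A(x)+A(y)$ for all $x,y\in X$. A function $B:X\times X\to Y$ is symmetric bi-additive if $B(x,y)=B(y,x)$ for all $x,y\in X$ and $B$ is additive in each variable. For $C:X\times X\times X\to Y$: ''symmetric for each fixed one variable'' means that whenever any one of the three variables is fixed, $C$ is symmetric as a function of the other two; ''additive for fixed two variables'' means that whenever any two of the three variables are fixed, $C$ is additive as a function of the remaining one. *)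

(* Defs.v *)
From mathcomp Require Import all_boot all_order all_algebra.
From mathcomp Require Import reals.

Set Implicit Arguments.
Unset Strict Implicit.
Unset Printing Implicit Defensive.

Import GRing.Theory.
Local Open Scope ring_scope.

Section Additivity.
Context {X Y : zmodType}.

Definition additive_fun (A : X -> Y) : Prop :=
  forall x y, A (x + y) = A x + A y.

Definition symmetric2 (B : X -> X -> Y) : Prop :=
  forall x y, B x y = B y x.

Definition biadditive (B : X -> X -> Y) : Prop :=
  (forall y, additive_fun (fun x => B x y)) /\
  (forall x, additive_fun (fun y => B x y)).

Definition symmetric3 (C : X -> X -> X -> Y) : Prop :=
  [/\ forall x, symmetric2 (fun y z => C x y z),
      forall y, symmetric2 (fun x z => C x y z) &
      forall z, symmetric2 (fun x y => C x y z)].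

Definition triadditive (C : X -> X -> X -> Y) : Prop :=
  [/\ forall y z, additive_fun (fun x => C x y z),
      forall x z, additive_fun (fun y => C x y z) &
      forall x y, additive_fun (fun z => C x y z)].

End Additivity.

(* Main.v *)
Require Import Defs.
From HB Require Import structures.
From mathcomp Require Import all_boot all_order all_algebra.
From mathcomp Require Import boolp reals.

Set Implicit Arguments.
Unset Strict Implicit.
Unset Printing Implicit Defensive.

Import GRing.Theory Num.Theory.
Local Open Scope ring_scope.

(** Write [delta h f x] for the difference [f (x + h) - f x].  A function is a
    sum of a cubic, a quadratic and an additive diagonal exactly when it
    vanishes at 0 and all its fourth differences
    [delta u4 (delta u3 (delta u2 (delta u1 f)))] vanish.

    From the equation to the decomposition.  Since [k ^+ 2 != 1], the equation
    expresses [f x] as a combination of functions of [x + k *: y],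
    [x - k *: y], [x + y] and [x - y], where [y] is free.  Moving [x] by [h]
    and [y] by the multiple of [h] that keeps one of these four points fixed,
    then subtracting, eliminates the corresponding term and replaces [f] by
    [delta h f].  Four such moves, with independent steps, show that every
    fourth difference of [f] is zero ([iter_delta_eq0]).  The third differences
    are then constant functions, and one sixth of [delta x (delta y (delta z f))]
    is a symmetric triadditive [C] whose diagonal has the same third differences
    as [f].  Subtracting this diagonal lowers the degree by one, and the same
    argument gives [B] and then [A] ([delta3_decomposition],
    [delta4_decomposition]).

    From the decomposition to the equation.  The equation says that the central
    second difference [f (x + h) + f (x - h) - f x *+ 2] gets multiplied by
    [k ^+ 2] when [h] is replaced by [k *: h].  It equals
    [delta h (delta h f) (x - h)], and for [f] the sum of the three diagonals
    this is [C x h h *+ 6 + B h h *+ 2], which is quadratic in [h]. *)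

(** * Differences *)

Section Delta.
Context {X Y : zmodType}.
Implicit Types (f g : X -> Y) (h x : X).

Definition delta h f : X -> Y := fun x => f (x + h) - f x.

Lemma deltaC h1 h2 f : delta h1 (delta h2 f) = delta h2 (delta h1 f).
Proof.
apply: funext => x.
by rewrite /delta !opprB addrACA [- _ - _]addrC addrACA (addrAC x).
Qed.

Lemma deltaD h f g :
  delta h (fun x => f x + g x) = fun x => delta h f x + delta h g x.
Proof. by apply: funext => x; rewrite /delta opprD addrACA. Qed.

Lemma deltaB h f g :
  delta h (fun x => f x - g x) = fun x => delta h f x - delta h g x.
Proof.
by apply: funext => x; rewrite /delta !opprB addrACA [- _ - _]addrC addrACA.
Qed.

Lemma deltaMn h f n :
  delta h (fun x => f x *+ n) = fun x => delta h f x *+ n.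
Proof. by apply: funext => x; rewrite /delta mulrnBl. Qed.

Lemma delta_cst h (c : Y) : delta h (fun=> c) = fun=> 0.
Proof. by apply: funext => x; rewrite /delta subrr. Qed.

Lemma delta_eq0_cst f : (forall h x, delta h f x = 0) -> forall x, f x = f 0.
Proof. by move=> f_cst x; apply/subr0_eq; rewrite -(f_cst x 0) /delta add0r. Qed.

(** The cocycle identity [delta (h + h') f x = delta h f (x + h') + delta h' f x]
    is the source of additivity: the base point [x + h'] no longer matters as
    soon as [delta h f] is constant. *)
Lemma delta_cst_additive f :
  (forall h1 h2 x, delta h1 (delta h2 f) x = 0) ->
  additive_fun (fun h => delta h f 0).
Proof.
move=> f2 h1 h2; have := delta_eq0_cst (fun h x => f2 h h1 x) h2.
by rewrite /delta !add0r => <-; rewrite addrA subrK (addrC h1).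
Qed.

(** With second differences zero and [f 0 = 0], the additive function of the
    previous lemma is [f] itself. *)
Lemma delta2_decomposition f :
  f 0 = 0 -> (forall h1 h2 x, delta h1 (delta h2 f) x = 0) -> additive_fun f.
Proof.
move=> f0 /delta_cst_additive fD x y; have := fD x y.
by rewrite /delta !add0r f0 !subr0.
Qed.

(** The shifted base point [x - h] is what turns the symmetric expression on
    the left into an iterated forward difference. *)
Lemma central_difference f h x :
  f (x + h) + f (x - h) = delta h (delta h f) (x - h) + f x *+ 2.
Proof.
by rewrite /delta subrK opprB mulr2n addrACA !subrK.
Qed.

(** * Differences of diagonals *)

Lemma delta_additive (A : X -> Y) h : additive_fun A -> delta h A = fun=> A h.
Proof. by move=> AD; apply: funext => x; rewrite /delta AD addrC addKr. Qed.

Lemma delta_diag2 (B : X -> X -> Y) h : symmetric2 B -> biadditive B ->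
  delta h (fun x => B x x) = fun x => B x h *+ 2 + B h h.
Proof.
move=> Bsym [Bl Br]; apply: funext => x.
by rewrite /delta Bl !Br (Bsym h x) mulr2n -!addrA [LHS]addrC !addrA addrNK.
Qed.

Lemma delta_delta_diag2 (B : X -> X -> Y) h1 h2 : symmetric2 B -> biadditive B ->
  delta h1 (delta h2 (fun x => B x x)) = fun=> B h1 h2 *+ 2.
Proof.
move=> Bsym Badd; rewrite delta_diag2 // deltaD delta_cst deltaMn.
by apply: funext => x; rewrite addr0 (delta_additive _ (Badd.1 h2)).
Qed.

Section Cubic.
Variable C : X -> X -> X -> Y.
Hypotheses (Csym : symmetric3 C) (Cadd : triadditive C).

Lemma symmetric3_slice z : symmetric2 (fun x y => C x y z).
Proof. by case: Csym. Qed.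

Lemma triadditive_slice z : biadditive (fun x y => C x y z).
Proof. by case: Cadd => ? ? _; split=> ?. Qed.

Lemma delta_diag3 h : delta h (fun x => C x x x) =
  fun x => C x x h *+ 3 + C x h h *+ 3 + C h h h.
Proof.
case: Csym Cadd => C23 C13 C12 [Cl Cm Cr]; apply: funext => x.
rewrite /delta Cl !Cm !Cr.
rewrite (C12 x h x) (C23 x h x) (C23 h h x) (C12 h h x).
rewrite [LHS]addrC !addrA addNr add0r (addrAC _ (C x h h) (C x x h)).
by rewrite !mulrS !mulr0n !addr0 !addrA.
Qed.

Lemma delta_delta_diag3 h1 h2 : delta h1 (delta h2 (fun x => C x x x)) =
  fun x => C x h1 h2 *+ 6 + C h1 h1 h2 *+ 3 + C h1 h2 h2 *+ 3.
Proof.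
case: (Cadd) => Cl _ _.
rewrite delta_diag3 2!deltaD delta_cst !deltaMn.
rewrite (delta_diag2 _ (symmetric3_slice h2) (triadditive_slice h2)).
rewrite (delta_additive _ (Cl h2 h2)).
by apply: funext => x; rewrite addr0 mulrnDl -mulrnA.
Qed.

Lemma delta3_diag3 h1 h2 h3 :
  delta h1 (delta h2 (delta h3 (fun x => C x x x))) = fun=> C h1 h2 h3 *+ 6.
Proof.
case: (Cadd) => Cl _ _.
rewrite delta_delta_diag3 2!deltaD !delta_cst deltaMn (delta_additive _ (Cl h2 h3)).
by apply: funext => x; rewrite !addr0.
Qed.

End Cubic.
End Delta.

(** Scaling by an integer is iterated addition, so additive functions commute
    with it although they need not be linear over the scalars. *)
Lemma additive_scale_int (R : pzRingType) (X Y : lmodType R) (A : X -> Y)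
    (k : int) (x : X) : additive_fun A -> A (k%:~R *: x) = k%:~R *: A x.
Proof.
move=> AD.
have A0 : A 0 = 0 by apply: (addrI (A 0)); rewrite -AD !addr0.
pose a : {additive X -> Y} :=
  HB.pack A (GRing.isNmodMorphism.Build X Y A (conj A0 AD)).
by rewrite !scaler_int; exact: (raddfMz a).
Qed.

(** * Functions with vanishing higher differences *)

Section Decomposition.
Context {R : numFieldType} {X Y : lmodType R}.
Implicit Types f : X -> Y.

Lemma scale_invn_mulrn n (v : Y) : (n.+1%:R^-1 *: v) *+ n.+1 = v.
Proof. by rewrite -[LHS]scaler_nat scalerA mulfV ?scale1r ?pnatr_eq0. Qed.

(** [delta x (delta y f)] is a constant function, additive in [x] and in [y].
    By [delta_delta_diag2] a diagonal [B x x] has second differences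
    [B h1 h2 *+ 2], hence the factor one half in the choice of [B]; what remains
    of [f] then has zero second differences. *)
Lemma delta3_decomposition f : f 0 = 0 ->
  (forall h1 h2 h3 x, delta h1 (delta h2 (delta h3 f)) x = 0) ->
  exists (B : X -> X -> Y) (A : X -> Y),
    [/\ forall x, f x = B x x + A x,
        symmetric2 B, biadditive B & additive_fun A].
Proof.
move=> f0 f3; pose B x y := 2%:R^-1 *: delta x (delta y f) 0.
have Bsym : symmetric2 B by move=> x y; rewrite /B deltaC.
have Bl y : additive_fun (B^~ y).
  by move=> x x'; rewrite /B (delta_cst_additive (fun h1 h2 => f3 h1 h2 y)) scalerDr.
have Badd : biadditive B.
  by split=> [//|x y y']; rewrite (Bsym x) Bl !(Bsym _ x).
exists B, (fun x => f x - B x x); split=> // [x|].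
  by rewrite addrC subrK.
apply: delta2_decomposition => [|h1 h2 x].
  by rewrite f0 /B /delta !addr0 !subrr scaler0 subrr.
rewrite (deltaB h2) (deltaB h1) delta_delta_diag2 // scale_invn_mulrn.
by rewrite (delta_eq0_cst (fun h x => f3 h h1 h2 x) x) subrr.
Qed.

(** Same descent, one degree higher: by [delta3_diag3] the factor is one
    sixth. *)
Lemma delta4_decomposition f : f 0 = 0 ->
  (forall h1 h2 h3 h4 x,
     delta h1 (delta h2 (delta h3 (delta h4 f))) x = 0) ->
  exists (C : X -> X -> X -> Y) (B : X -> X -> Y) (A : X -> Y),
    (forall x, f x = C x x x + B x x + A x) /\
    [/\ symmetric3 C, triadditive C, symmetric2 B, biadditive B
      & additive_fun A].
Proof.
move=> f0 f4; pose C x y z := 6%:R^-1 *: delta x (delta y (delta z f)) 0.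
have C12 x y z : C x y z = C y x z by rewrite /C deltaC.
have C23 x y z : C x y z = C x z y by rewrite /C (deltaC y).
have Csym : symmetric3 C.
  by split=> ? ? ?; [exact: C23 | rewrite C12 C23 C12 | exact: C12].
have Cl y z : additive_fun (fun x => C x y z).
  move=> x x'; rewrite /C.
  by rewrite (delta_cst_additive (fun h1 h2 => f4 h1 h2 y z)) scalerDr.
have Cadd : triadditive C.
  split=> [//|x z y y'|x y z z']; first by rewrite !(C12 x) Cl.
  by rewrite !(C23 x y) !(C12 x) Cl.
have [||B [A [gE Bsym Badd AD]]] :=
    @delta3_decomposition (fun x => f x - C x x x).
- by rewrite f0 /C /delta !addr0 !subrr scaler0 subrr.
- move=> h1 h2 h3 x; rewrite (deltaB h3) (deltaB h2) (deltaB h1) delta3_diag3 // scale_invn_mulrn.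
  by rewrite (delta_eq0_cst (fun h x => f4 h h1 h2 h3 x) x) subrr.
exists C, B, A; split=> // x.
by rewrite -addrA -gE addrC subrK.
Qed.

End Decomposition.

(** * Elimination of terms in a linear functional equation *)

(** Replacing [x] by [x + h] and [y] by [y - b^-1 *: h] fixes the point
    [x + b *: y] and moves every other [x + c *: y] by [(1 - c / b) *: h].
    The difference of the two instances of the equation has one term less,
    with [delta h F0] on the left and the remaining [F] replaced by their
    differences with steps depending on [c], so induction on the length of the
    list applies. *)
Lemma iter_delta_eq0 (K : fieldType) (X Y : lmodType K) (s : seq (K * (X -> Y)))
    (F0 : X -> Y) (hs : seq X) :
  all (fun t => t.1 != 0) s ->
  (forall x y, F0 x = \sum_(t <- s) t.2 (x + t.1 *: y)) ->
  size hs = size s ->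
  forall x, foldl (fun F h => delta h F) F0 hs x = 0.
Proof.
have [n] := ubnP (size s).
elim: n s F0 hs => // n IHn [|[b F] s] F0 [|h hs] //=.
  by move=> _ _ F0E _ x; rewrite (F0E x 0) big_nil.
move=> lt_s_n /andP[b_neq0 s_neq0] F0E [size_hs].
(* The steps in [s'] are chosen so that moving [x] and [y] together acts on
   each remaining term as one difference. *)
pose s' := [seq (t.1, delta ((1 - t.1 / b) *: h) t.2) | t <- s].
apply: (IHn s'); rewrite ?size_map ?all_map // => x y.
rewrite /delta (F0E (x + h) (y - b^-1 *: h)) (F0E x y) !big_cons /= big_map.
have -> : x + h + b *: (y - b^-1 *: h) = x + b *: y.
  by rewrite scalerBr scalerA mulfV // scale1r addrA addrAC addrK.
rewrite opprD addrACA subrr add0r -sumrB; apply: eq_bigr => -[c G] _ /=.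
congr (G _ - _).
rewrite scalerBr scalerA scalerBl scale1r addrACA.
by rewrite -addrA addrCA addrC !addrA.
Qed.

(** * The functional equation *)

Theorem theorem2p3 (R : realType) (X Y : lmodType R) (k : int)
    (k_neq0 : k <> 0) (k_neq1 : k <> 1) (k_neqN1 : k <> -1)
    (f : X -> Y) (f0 : f 0 = 0) :
  (forall x y : X,
     f (x + k%:~R *: y) + f (x - k%:~R *: y) =
       (k%:~R ^+ 2) *: f (x + y) + (k%:~R ^+ 2) *: f (x - y)
       + (2 * (1 - k%:~R ^+ 2)) *: f x)
  <->
  (exists (C : X -> X -> X -> Y) (B : X -> X -> Y) (A : X -> Y),
     (forall x : X, f x = C x x x + B x x + A x) /\
     [/\ symmetric3 C, triadditive C, symmetric2 B, biadditive B
       & additive_fun A]).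
Proof.
split.
  move=> fE; pose a : R := 2 * (1 - k%:~R ^+ 2).
  have a_neq0 : a != 0.
    rewrite mulf_neq0 ?pnatr_eq0 // subr_eq0 eq_sym sqrf_eq1 -[-1]/((-1)%:~R).
    rewrite -[1]/(1%:~R) !eqr_int; apply/norP.
    by split; apply/eqP.
  (* The equation solved for [f x]: the pairs are the directions of [y] with
     the functions evaluated there. *)
  pose s : seq (R * (X -> Y)) :=
    [:: (k%:~R, fun x => a^-1 *: f x); (- k%:~R, fun x => a^-1 *: f x);
        (1, fun x => (- a^-1 * k%:~R ^+ 2) *: f x);
        (-1, fun x => (- a^-1 * k%:~R ^+ 2) *: f x)].
  apply: delta4_decomposition => // h1 h2 h3 h4.
  apply: (@iter_delta_eq0 _ _ _ s f [:: h4; h3; h2; h1]) => // [|x y].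
    by rewrite /= !oppr_eq0 oner_eq0 intr_eq0 !andbT andbb; apply/eqP.
  rewrite /s !big_cons big_nil /= addr0 !scaleNr !scale1r.
  apply: (scalerI a_neq0).
  rewrite !scalerDr !scalerA.
  rewrite mulrA mulrN mulfV // mulN1r !scale1r !scaleNr.
  by rewrite addrA fE -opprD addrAC subrr add0r.
case=> C [B] [A] [fE [Csym Cadd Bsym Badd AD]] x y.
have second_difference h :
    f (x + h) + f (x - h) = C x h h *+ 6 + B h h *+ 2 + f x *+ 2.
  rewrite central_difference; congr (_ + _); rewrite (funext fE).
  rewrite (deltaD h (fun x => C x x x + B x x) A) (delta_additive h AD).
  rewrite (deltaD h (fun x => C x x x)) 2!(deltaD h) delta_cst addr0.
  rewrite delta_delta_diag3 // delta_delta_diag2 //; congr (_ + _).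
  have [Cl _ _] := Cadd.
  (* The base point [x - h] absorbs the terms in [C h h h]. *)
  have -> : C x h h = C (x - h) h h + C h h h by rewrite -Cl subrK.
  by rewrite -addrA -mulrnDr mulrnDl.
have C_homogeneous : C x (k%:~R *: y) (k%:~R *: y) = k%:~R ^+ 2 *: C x y y.
  have [_ Cm Cr] := Cadd.
  rewrite (additive_scale_int k y (Cm x _)) (additive_scale_int k y (Cr x y)).
  by rewrite scalerA.
have B_homogeneous : B (k%:~R *: y) (k%:~R *: y) = k%:~R ^+ 2 *: B y y.
  have [Bl Br] := Badd.
  rewrite (additive_scale_int k y (Bl _)) (additive_scale_int k y (Br y)).
  by rewrite scalerA.
rewrite -scalerDr !second_difference C_homogeneous B_homogeneous.
rewrite !scalerMnr -scalerDr [in RHS]scalerDr -[RHS]addrA; congr (_ + _).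
rewrite -[f x *+ 2]scaler_nat scalerA -scalerDl mulrBr mulr1.
by rewrite [_ * 2]mulrC addrC subrK.
Qed.
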